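(* If $D$ and $H$ are Bott equivalent acyclic digraphs, then $D$ and $H$ have the same rank.
   Context: A digraph $D=(V,E)$ consists of a finite vertex set $V$ and a set $E$ of ordered pairs $(u,v)$ of distinct vertices (arcs). $D$ is acyclic if its vertices can be ordered $v_1,\dots,v_n$ so that $i<j$ for each arc $(v_i,v_j)$. Let $N_D^+(v)=\{w:(v,w)\in E\}$ (out-neighbors) and $N_D^-(v)=\{u:(u,v)\in E\}$ (in-neighbors). Bott equivalence. Local complementation at a vertex $v$: $D*v$ is the digraph obtained from $D$ by toggling (adding if absent, removing if present) the arc $(u,w)$ for each pair $(u,w)\in N_D^-(v)\times N_D^+(v)$ with $u\ne w$. Slide: for two distinct vertices $v,w$ with $N_D^-(v)=N_D^-(w)$, $D\Delta vw$ is the digraph obtained from $D$ by replacing $N_D^+(w)$ by the symmetric difference $N_D^+(w)\Delta N_D^+(v)$. These operations preserve acyclicity. An acyclic digraph $H$ is Bott equivalent to an acyclic digraph $D$ if $H$ is isomorphic to a digraph obtained from $D$ by successively applying (finitely many) local complementations and slides. Rank. The adjacency matrix $A_D$ of $D$ has rows and columns indexed by $V$, with $(u,v)$ entry $1$ if $(u,v)\in E$ and $0$ otherwise. The rank of $D$ is the rank of $A_D$ over $\mathbb{Z}_2$. *)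

(* Defs.v *)
From mathcomp Require Import all_boot all_algebra.

Set Implicit Arguments.
Unset Strict Implicit.
Unset Printing Implicit Defensive.

Record digraph (V : finType) := Digraph {
  arcs : {set V * V};
  arcs_loopless : forall v : V, (v, v) \notin arcs
}.

Section Digraph.

Variable V : finType.
Implicit Types (D : digraph V) (u v w : V).

Definition arc D u v : bool := (u, v) \in arcs D.

Definition acyclic D : Prop :=
  exists2 f : 'I_#|V| -> V,
    bijective f & forall i j : 'I_#|V|, arc D (f i) (f j) -> i < j.

Definition out_nbrs D v : {set V} := [set w | arc D v w].
Definition in_nbrs D v : {set V} := [set u | arc D u v].

(* The exclusive or toggles membership. *)
Definition local_compl_arcs D v : {set V * V} :=
  [set a | (a \in arcs D)
     (+) [&& a.1 \in in_nbrs D v, a.2 \in out_nbrs D v & a.1 != a.2]].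

Lemma local_compl_loopless D v u : (u, u) \notin local_compl_arcs D v.
Proof. by rewrite inE /= eqxx !andbF addbF arcs_loopless. Qed.

Definition local_compl D v : digraph V :=
  Digraph (local_compl_loopless D v).

Definition symdiff (A B : {set V}) : {set V} := (A :\: B) :|: (B :\: A).

Definition slide_arcs D v w : {set V * V} :=
  [set a | if a.1 == w then a.2 \in symdiff (out_nbrs D w) (out_nbrs D v)
           else a \in arcs D].

(* Equal in-neighborhoods rule out the arc (v, w), so no loop arises at w. *)
Lemma slide_loopless D v w (eq_in : in_nbrs D v = in_nbrs D w) u :
  (u, u) \notin slide_arcs D v w.
Proof.
rewrite inE /=; case: eqP => [->|_]; last exact: arcs_loopless.
have : v \in in_nbrs D w = false.
  by rewrite -eq_in inE /arc; apply/negbTE/arcs_loopless.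
by rewrite !inE /arc => ->; rewrite (negbTE (arcs_loopless D w)) andbF.
Qed.

Definition slide D v w (eq_in : in_nbrs D v = in_nbrs D w) : digraph V :=
  Digraph (slide_loopless eq_in).

Inductive bott_reachable D : digraph V -> Prop :=
| bott_refl : bott_reachable D D
| bott_local_compl D' v :
    bott_reachable D D' -> bott_reachable D (local_compl D' v)
| bott_slide D' v w (eq_in : in_nbrs D' v = in_nbrs D' w) :
    v != w -> bott_reachable D D' -> bott_reachable D (slide eq_in).

(* Rows and columns are indexed through the enumeration of V. *)
Definition adjacency_matrix D : 'M['F_2]_#|V| :=
  (\matrix_(i, j) (arc D (enum_val i) (enum_val j))%:R)%R.

Definition digraph_rank D : nat := \rank (adjacency_matrix D).

End Digraph.

Definition isomorphic (V W : finType) (D : digraph V) (H : digraph W) : Prop :=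
  exists2 f : V -> W,
    bijective f & forall u v : V, arc H (f u) (f v) = arc D u v.

Definition bott_equivalent (V W : finType) (H : digraph W) (D : digraph V) :
    Prop :=
  exists2 D' : digraph V, bott_reachable D D' & isomorphic H D'.

(* Main.v *)
(** Over F_2 a local complementation at [v] turns the adjacency matrix [A] into
    [A + (A e_v) (e_v^T A) = A (1 + e_v e_v^T A)], and a slide turns it into
    [(1 + e_w e_v^T) A].  Both factors are of the form [1 + c r] with [r c = 0],
    hence invertible.  The first identity needs acyclicity (an in-neighbor of [v]
    is never an out-neighbor of [v]), which therefore has to be carried along
    both operations. *)

Require Import Defs.
From mathcomp Require Import all_boot all_algebra.

Import GRing.Theory.

(* The later import of [path] hides [Defs.arc]. *)
Local Notation arc := Defs.arc.

Section RankOneUpdate.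

Local Open Scope ring_scope.

Variables (F : fieldType) (n : nat).
Implicit Types (A : 'M[F]_n) (i j : 'I_n).

(** The square of [c *m r] contains the factor [r *m c], so it vanishes and [1%:M - c *m r] is the
    inverse. *)
Lemma unitmx_add_rank1 (c : 'cV[F]_n) (r : 'rV[F]_n) :
  r *m c = 0 -> 1%:M + c *m r \in unitmx.
Proof.
move=> rc0; have : (1%:M + c *m r) *m (1%:M - c *m r) = 1%:M.
  rewrite mulmxDl !mulmxBr !mul1mx mulmx1 mulmxA -(mulmxA c) rc0 mulmx0 mul0mx.
  by rewrite subr0 subrK.
by case/mulmx1_unit.
Qed.

Lemma mxrank_add_col_row A i :
  A i i = 0 -> \rank (A + col i A *m row i A)%R = \rank A.
Proof.
move=> Aii0.
have -> : A + col i A *m row i A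
        = A *m (1%:M + (delta_mx i 0 : 'cV_n) *m row i A).
  by rewrite mulmxDr mulmx1 mulmxA -colE.
rewrite mxrankMfree // row_free_unit; apply: unitmx_add_rank1.
(* Here [r *m c] is the 1-by-1 matrix with entry [A i i]. *)
by rewrite -colE; apply/matrixP=> a b; rewrite !mxE.
Qed.

Lemma mxrank_add_row A i j :
  i != j -> \rank (A + (delta_mx i 0 : 'cV_n) *m row j A)%R = \rank A.
Proof.
move=> neq_ij.
have -> : A + (delta_mx i 0 : 'cV_n) *m row j A
        = (1%:M + (delta_mx i 0 : 'cV_n) *m (delta_mx 0 j : 'rV_n)) *m A.
  by rewrite mulmxDl mul1mx rowE mulmxA.
rewrite -mxrank_tr trmx_mul mxrankMfree ?mxrank_tr //.
rewrite row_free_unit unitmx_tr; apply: unitmx_add_rank1.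
by rewrite mul_delta_mx_cond eq_sym (negbTE neq_ij).
Qed.

End RankOneUpdate.

(** Selecting rows and columns amounts to multiplying on the left and right by submatrices of the
    identity. *)
Lemma mxrank_mxsub_le (F : fieldType) (m n p q : nat) (f : 'I_p -> 'I_m)
    (g : 'I_q -> 'I_n) (A : 'M[F]_(m, n)) :
  \rank (mxsub f g A) <= \rank A.
Proof.
rewrite -{1}[A]mulmx1 mxsub_mul (leq_trans (mxrankM_maxl _ _)) //.
by rewrite rowsubE mxrankM_maxr.
Qed.

Section Invariance.

Variable V : finType.
Implicit Types (D : digraph V) (u v w : V).

(* Unlike the linear order in [acyclic], a height function survives a slide by
   changing a single value. *)
Definition has_height D : Prop :=
  exists h : V -> nat, forall u v, arc D u v -> h u < h v.

Lemma acyclic_has_height D : acyclic D -> has_height D.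
Proof.
case=> f [g fK gK] f_inc; exists (fun v => g v : nat) => u v.
by rewrite -{1}(gK u) -{1}(gK v) => /f_inc.
Qed.

(** Each toggled pair is joined by a path of length two through [v], so the old heights increase
    along any added arc. *)
Lemma has_height_local_compl D v : has_height D -> has_height (local_compl D v).
Proof.
case=> h h_inc; exists h => u w; rewrite /arc !inE /=.
case: (boolP (_ \in arcs D)) => [/h_inc //|_] /=.
by case/and3P=> /h_inc huv /h_inc hvw _; apply: ltn_trans hvw.
Qed.

Lemma has_height_slide D v w (eq_in : in_nbrs D v = in_nbrs D w) :
  has_height D -> has_height (slide eq_in).
Proof.
case=> h h_inc.
(* The new out-neighbors of [w] are among those of [v] and the old [w], so the minimum lies below
   them; an arc into [w] comes with one into [v], hence starts below both. *)
exists (fun x => if x == w then minn (h v) (h w) else h x) => u x.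
rewrite /arc inE /=; case: (altP (u =P w)) => [_|_].
  case: (altP (x =P w)) => [->|_]; last first.
    by rewrite !inE gtn_min; case/orP=> /andP[_ /h_inc ->]; rewrite ?orbT.
  by move=> ww; case/negP: (slide_loopless eq_in w); rewrite inE eqxx.
case: (altP (x =P w)) => [->|_] uw; last exact: h_inc.
have : u \in in_nbrs D v by rewrite eq_in inE.
by rewrite inE leq_min (h_inc _ _ uw) andbT; apply: h_inc.
Qed.

Lemma digraph_rank_local_compl D v :
  has_height D -> digraph_rank (local_compl D v) = digraph_rank D.
Proof.
case=> h h_inc; rewrite /digraph_rank.
set A := adjacency_matrix D; set i := enum_rank v.
have Aii0 : (A i i = 0)%R by rewrite mxE /arc (negbTE (arcs_loopless D _)).
rewrite -(mxrank_add_col_row _ _ A i Aii0); congr (\rank _).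
apply/matrixP=> a b; rewrite !mxE big_ord1 !mxE enum_rankK.
set x := enum_val a; set y := enum_val b.
rewrite {1}/arc !inE /= -/(arc D x y).
(* A path through [v] strictly raises the height, so its ends differ and the toggle is exactly the
   product of a column and a row. *)
have -> : [&& arc D x v, arc D v y & x != y] = arc D x v && arc D v y.
  case: (boolP (arc D x v)) => //= /h_inc hxv.
  case: (boolP (arc D v y)) => //= /h_inc hvy.
  by apply: contraTneq (ltn_trans hxv hvy) => ->; rewrite ltnn.
by case: (arc D x y); case: (arc D x v); case: (arc D v y); apply/val_inj.
Qed.

Lemma digraph_rank_slide D v w (eq_in : in_nbrs D v = in_nbrs D w) :
  v != w -> digraph_rank (slide eq_in) = digraph_rank D.
Proof.
move=> neq_vw; rewrite /digraph_rank.
set A := adjacency_matrix D.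
have neq_ij : enum_rank w != enum_rank v.
  by rewrite (inj_eq enum_rank_inj) eq_sym.
rewrite -(mxrank_add_row _ _ A _ _ neq_ij); congr (\rank _).
apply/matrixP=> a b; rewrite !mxE big_ord1 !mxE enum_rankK andbT.
rewrite -(inj_eq enum_val_inj) enum_rankK.
set x := enum_val a; set y := enum_val b.
rewrite {1}/arc !inE /= -/(arc D x y).
case: (altP (x =P w)) => [->|_]; last by rewrite mul0r addr0.
by case: (arc D w y); case: (arc D v y); apply/val_inj.
Qed.

Lemma bott_reachable_rank D D' :
  has_height D -> bott_reachable D D' ->
  has_height D' /\ digraph_rank D' = digraph_rank D.
Proof.
move=> hD; elim=> [//|E v _ [hE <-]|E v w eq_in neq_vw _ [hE <-]].
  by split; [apply: has_height_local_compl | apply: digraph_rank_local_compl].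
by split; [apply: has_height_slide | apply: digraph_rank_slide].
Qed.

End Invariance.

Lemma digraph_rank_induced_le (V W : finType) (D : digraph V) (H : digraph W)
    (f : W -> V) :
  (forall u v, arc D (f u) (f v) = arc H u v) ->
  digraph_rank H <= digraph_rank D.
Proof.
move=> fE; pose s (i : 'I_#|W|) := enum_rank (f (enum_val i)).
suff eqH : adjacency_matrix H = mxsub s s (adjacency_matrix D).
  by rewrite /digraph_rank eqH mxrank_mxsub_le.
by apply/matrixP=> i j; rewrite !mxE !enum_rankK fE.
Qed.

(** Two inequalities, from the isomorphism and its inverse, avoid identifying the index types
    ['I_#|V|] and ['I_#|W|]. *)
Lemma isomorphic_rank (V W : finType) (D : digraph V) (H : digraph W) :
  isomorphic D H -> digraph_rank D = digraph_rank H.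
Proof.
case=> f [g fK gK] fE; apply/eqP; rewrite eqn_leq.
rewrite (digraph_rank_induced_le _ _ _ _ f) //=.
by apply: (digraph_rank_induced_le _ _ _ _ g) => u v; rewrite -fE !gK.
Qed.

Theorem proposition5p2 (V W : finType) (D : digraph V) (H : digraph W)
    (acyclic_D : acyclic D) (acyclic_H : acyclic H)
    (bott_HD : bott_equivalent H D) :
  digraph_rank D = digraph_rank H.
Proof.
case: bott_HD => D' reach /isomorphic_rank ->.
by have [_ ->] := bott_reachable_rank _ _ _ (acyclic_has_height _ _ acyclic_D) reach.
Qed.
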